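(* Let $\mathbb F$ be a field. The null space of a matrix determines its row space and its RREF, in the following sense. Let $M$ be a $p\times q$ matrix and $M'$ a $p'\times q$ matrix over $\mathbb F$ with $\operatorname{null}(M)=\operatorname{null}(M')$. Then $M$ and $M'$ have the same row space. If moreover $p=p'$, then $\mathrm{RREF}(M)=\mathrm{RREF}(M')$; hence two matrices of the same size that have the same null space are row equivalent.
   Context: For a $p\times q$ matrix $M$ over $\mathbb F$, $\operatorname{null}(M)=\{\vec x\in\mathbb F^q : M\vec x=\vec 0\}$ is the (right) null space, and the row space is the span in $\mathbb F^q$ of the rows of $M$. Row operations on a matrix are: scaling a row by a nonzero scalar, interchanging two rows, and subtracting a scalar multiple of one row from another row. Two matrices of the same size are row equivalent if one is obtained from the other by a finite sequence of row operations. A matrix $E$ is in row reduced echelon form (RREF) if: (i) in each row of $E$, the first nonzero entry from the left, if any, is a $1$ (this entry, and also its column, is called a pivot); (ii) in each pivot column, the pivot entry $1$ is the only nonzero entry; (iii) if a pivot entry $1$ is to the right of another pivot entry, it is also lower down; (iv) rows consisting entirely of zeros, if any, are at the bottom of the matrix. $\mathrm{RREF}(M)$ denotes the unique matrix in RREF that is row equivalent to $M$. *)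

(* Defs.v *)
From HB Require Import structures.
From mathcomp Require Import all_boot all_order perm all_algebra.
From Stdlib Require Import Relation_Operators.

Set Implicit Arguments.
Unset Strict Implicit.
Unset Printing Implicit Defensive.

Import GRing.Theory.
Local Open Scope ring_scope.

Definition null (F : fieldType) (p q : nat) (M : 'M[F]_(p, q)) :
  {pred 'cV[F]_q} := [pred x : 'cV[F]_q | M *m x == 0].

Definition row_space (F : fieldType) (p q : nat) (M : 'M[F]_(p, q)) :
  {vspace 'rV[F]_q} := <<[seq row i M | i : 'I_p]>>%VS.

Definition scale_row (F : fieldType) (p q : nat) (i : 'I_p) (c : F)
    (M : 'M[F]_(p, q)) : 'M[F]_(p, q) :=
  \matrix_(l, j) (if l == i then c * M l j else M l j).

Definition sub_row (F : fieldType) (p q : nat) (k i : 'I_p) (c : F)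
    (M : 'M[F]_(p, q)) : 'M[F]_(p, q) :=
  \matrix_(l, j) (if l == k then M l j - c * M i j else M l j).

Inductive row_op (F : fieldType) (p q : nat) (M : 'M[F]_(p, q)) :
    'M[F]_(p, q) -> Prop :=
| RowScale i c of c != 0 : row_op M (scale_row i c M)
| RowSwap i k : row_op M (xrow i k M)
| RowSub k i c of k != i : row_op M (sub_row k i c M).

Definition row_equiv (F : fieldType) (p q : nat) :
    'M[F]_(p, q) -> 'M[F]_(p, q) -> Prop :=
  clos_refl_trans _ (@row_op F p q).

(* The leftmost nonzero entry of row i of E is in column j. *)
Definition pivot (F : fieldType) (p q : nat) (E : 'M[F]_(p, q))
    (i : 'I_p) (j : 'I_q) : bool :=
  (E i j != 0) && [forall j' : 'I_q, (j' < j)%N ==> (E i j' == 0)].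

Definition is_rref (F : fieldType) (p q : nat) (E : 'M[F]_(p, q)) : Prop :=
  [/\ forall i j, pivot E i j -> E i j = 1,
      forall i j, pivot E i j -> forall l : 'I_p, l != i -> E l j = 0,
      forall (i : 'I_p) (j : 'I_q) (i' : 'I_p) (j' : 'I_q),
        pivot E i j -> pivot E i' j' -> (j < j')%N -> (i < i')%N
    & forall i i' : 'I_p, row i E = 0 -> (i < i')%N -> row i' E = 0].

Lemma pivot_neq0 (F : fieldType) (p q : nat) (E : 'M[F]_(p, q)) i j :
  pivot E i j -> E i j != 0.
Proof. by case/andP. Qed.

Lemma pivot_lt (F : fieldType) (p q : nat) (E : 'M[F]_(p, q)) i (j j' : 'I_q) :
  pivot E i j -> (j' < j)%N -> E i j' = 0.
Proof. by case/andP=> _ /forallP/(_ j')/implyP H /H /eqP. Qed.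

Lemma pivot_le (F : fieldType) (p q : nat) (E : 'M[F]_(p, q)) i (j j' : 'I_q) :
  pivot E i j -> E i j' != 0 -> (j <= j')%N.
Proof. by move=> H; rewrite leqNgt; apply: contra => /(pivot_lt H) ->. Qed.

Lemma pivot_ex (F : fieldType) (p q : nat) (E : 'M[F]_(p, q)) i j :
  E i j != 0 -> exists j', pivot E i j'.
Proof.
move=> Eij; case: (@arg_minnP _ j (fun j => E i j != 0) (@nat_of_ord q) Eij).
move=> j' Eij' Hmin; exists j'; rewrite /pivot Eij' /=.
apply/forallP=> l; apply/implyP=> lj; apply: contraTT lj => /Hmin.
by rewrite leqNgt.
Qed.

Lemma pivot_row_inj (F : fieldType) (p q : nat) (E : 'M[F]_(p, q)) i (j j' : 'I_q) :
  pivot E i j -> pivot E i j' -> j = j'.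
Proof.
move=> H H'; apply/val_inj/eqP; rewrite eqn_leq.
by rewrite (pivot_le H (pivot_neq0 H')) (pivot_le H' (pivot_neq0 H)).
Qed.

Lemma eq_pivot (F : fieldType) (p q : nat) (E E' : 'M[F]_(p, q))
    (i : 'I_p) (j : 'I_q) :
  (forall j' : 'I_q, (j' <= j)%N -> E i j' = E' i j') ->
  pivot E i j = pivot E' i j.
Proof.
move=> eqE; rewrite /pivot eqE //; congr (_ && _).
by apply: eq_forallb => l; case: ltnP => // /ltnW /eqE ->.
Qed.

Lemma row_equiv_clear (F : fieldType) (p q : nat) (N : 'M[F]_(p, q))
    (r : 'I_p) (c : 'I_p -> F) :
  row_equiv N (\matrix_(l, j)
    (if l == r then N l j else N l j - c l * N r j)).
Proof.
pose Ns (s : seq 'I_p) := \matrix_(l, j)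
  (if (l != r) && (l \in s) then N l j - c l * N r j else N l j).
suff: row_equiv N (Ns (enum 'I_p)).
  congr row_equiv; apply/matrixP=> l j; rewrite !mxE mem_enum andbT.
  by case: eqP.
elim: (enum 'I_p) (enum_uniq 'I_p) => [_|x s IHs /= /andP[xs us]].
  suff ->: Ns [::] = N by apply: rt_refl.
  by apply/matrixP=> l j; rewrite !mxE andbF.
apply: rt_trans (IHs us) _.
have [xr|xr] := eqVneq x r.
  suff ->: Ns (x :: s) = Ns s by apply: rt_refl.
  by apply/matrixP=> l j; rewrite !mxE inE xr; case: eqP.
suff ->: Ns (x :: s) = sub_row x r (c x) (Ns s) by apply/rt_step/RowSub.
apply/matrixP=> l j; rewrite !mxE inE eqxx /=.
by have [->|] //= := eqVneq l x; rewrite xr (negPf xs).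
Qed.

(* Loop invariant of Gaussian elimination: the first k columns of E are in
   reduced echelon form and their nonzero rows are exactly the first r. *)
Definition rref_upto (F : fieldType) (p q k r : nat) (E : 'M[F]_(p, q)) :=
  [/\ forall (i : 'I_p) (j : 'I_q), (r <= i)%N -> (j < k)%N -> E i j = 0,
      forall i : 'I_p, (i < r)%N -> exists2 j : 'I_q, (j < k)%N & pivot E i j,
      forall (i : 'I_p) (j : 'I_q), (j < k)%N -> pivot E i j ->
        E i j = 1 /\ forall l : 'I_p, l != i -> E l j = 0
    & forall (i : 'I_p) (j : 'I_q) (i' : 'I_p) (j' : 'I_q), (j < k)%N -> (j' < k)%N -> pivot E i j ->
        pivot E i' j' -> (j < j')%N -> (i < i')%N].

Lemma rref_upto_step (F : fieldType) (p q k r : nat) (E : 'M[F]_(p, q)) :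
  (k < q)%N -> rref_upto k r E ->
  {E' : 'M[F]_(p, q) & {r' | row_equiv E E' & rref_upto k.+1 r' E'}}.
Proof.
move=> kq [H0 H1 H2 H3]; pose K := Ordinal kq.
have ltS (j : 'I_q) : (j < k.+1)%N -> (j < k)%N \/ j = K.
  rewrite ltnS leq_eqVlt => /orP[/eqP jk|]; last by left.
  by right; apply: val_inj.
have piv_ge (A : 'M[F]_(p, q)) (i : 'I_p) (j : 'I_q) :
    (forall (i : 'I_p) (j : 'I_q), (r <= i)%N -> (j < k)%N -> A i j = 0) ->
    (j < k)%N -> pivot A i j -> (i < r)%N.
  by move=> HA jk /pivot_neq0; rewrite ltnNge; apply: contra => /HA ->.
case: (pickP (fun i : 'I_p => (r <= i)%N && (E i K != 0))); last first.
  move=> none; exists E, r; first exact: rt_refl.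
  have zK (i : 'I_p) : (r <= i)%N -> E i K = 0.
    by move=> ri; apply/eqP; move: (none i); rewrite ri /= => /negbFE.
  have pivK (i : 'I_p) (j : 'I_q) : (j < k.+1)%N -> pivot E i j -> (j < k)%N.
    case/ltS=> // -> pK; case: (ltnP i r) => ri; last first.
      by move: (pivot_neq0 pK); rewrite zK ?eqxx.
    have [j' jk' pj'] := H1 _ ri.
    by rewrite -(pivot_row_inj pj' pK).
  split.
  - by move=> i j ri /ltS[/(H0 _ _ ri)|->] //; apply: zK.
  - by move=> i /H1[j jk pj]; exists j => //; apply: ltnW.
  - by move=> i j jk pj; apply: H2 => //; apply: pivK jk pj.
  - move=> i j i' j' jk jk' pj pj'; apply: H3 => //.
    + exact: pivK jk pj.
    + exact: pivK jk' pj'.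
move=> i0 /andP[ri0 nz]; pose R := Ordinal (leq_ltn_trans ri0 (ltn_ord i0)).
pose E1 := xrow R i0 E.
pose E2 := scale_row R (E1 R K)^-1 E1.
pose E3 := \matrix_(l, j)
  (if l == R then E2 l j else E2 l j - E2 l K * E2 R j).
have E1RK : E1 R K = E i0 K by rewrite !mxE tpermL.
have E12 : row_equiv E1 E2.
  by apply/rt_step/RowScale; rewrite invr_eq0 E1RK.
have e1 l (j : 'I_q) : (j < k)%N -> E1 l j = E l j.
  move=> jk; rewrite mxE; by case: tpermP => [->|->|//]; rewrite !H0.
have e2 l (j : 'I_q) : (j < k)%N -> E2 l j = E l j.
  move=> jk; rewrite mxE (e1 l j) //; have [->|//] := eqVneq l R.
  by rewrite H0 //= mulr0.
have e3 l (j : 'I_q) : (j < k)%N -> E3 l j = E l j.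
  move=> jk; rewrite mxE (e2 l j) // (e2 R j) // (H0 R) //= mulr0 subr0.
  by case: eqP.
have E2RK : E2 R K = 1 by rewrite mxE eqxx mulVf // E1RK.
have E3RK : E3 R K = 1 by rewrite mxE eqxx E2RK.
have E3K l : l != R -> E3 l K = 0.
  by move=> lR; rewrite mxE (negPf lR) E2RK mulr1 subrr.
have z3 (i : 'I_p) (j : 'I_q) : (r <= i)%N -> (j < k)%N -> E3 i j = 0.
  by move=> ri jk; rewrite e3 // H0.
have p3 i (j : 'I_q) : (j < k)%N -> pivot E3 i j = pivot E i j.
  by move=> jk; apply: eq_pivot => j' jj'; apply: e3; apply: leq_ltn_trans jk.
have pR : pivot E3 R K.
  rewrite /pivot E3RK oner_eq0; apply/forallP=> j; apply/implyP=> /= jk.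
  by rewrite z3 //=.
have pK i : pivot E3 i K -> i = R.
  by move=> /pivot_neq0; apply: contraNeq => /E3K ->.
exists E3, r.+1.
  apply: rt_trans (row_equiv_clear E2 R (fun l => E2 l K)).
  by apply: rt_trans E12; apply/rt_step/RowSwap.
split.
- move=> i j ri /ltS[jk|->]; first by rewrite z3 // ltnW.
  by apply: E3K; apply: contraTneq ri => ->; rewrite /= ltnn.
- move=> i; rewrite ltnS leq_eqVlt => /orP[/eqP ir|/H1[j jk pj]].
    by exists K => //; rewrite (_ : i = R) //; apply: val_inj.
  by exists j; rewrite ?p3 // ltnW.
- move=> i j /ltS[jk|->]; last first.
    by move=> /pK ->; split=> // l; apply: E3K.
  rewrite p3 // => /(H2 _ _ jk)[E1' El].
  by rewrite e3 //; split=> // l li; rewrite e3 // El.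
- move=> i j i' j' /ltS[jk|->] /ltS[jk'|->].
  + by rewrite !p3 //; apply: H3.
  + by move=> pj /pK -> _; apply: piv_ge z3 jk pj.
  + by move=> _ _ /= kj'; move: (ltn_trans kj' jk'); rewrite ltnn.
  + by rewrite ltnn.
Qed.

Lemma RREF_sig (F : fieldType) (p q : nat) (M : 'M[F]_(p, q)) :
  {E | row_equiv M E & is_rref E}.
Proof.
have H k : (k <= q)%N ->
    {E : 'M[F]_(p, q) & {r | row_equiv M E & rref_upto k r E}}.
  elim: k => [_|k IHk kq].
    by exists M, 0%N; [apply: rt_refl | split].
  have [E [r ME Er]] := IHk (ltnW kq).
  have [E' [r' EE' Er']] := rref_upto_step kq Er.
  by exists E', r' => //; apply: rt_trans ME EE'.
have [E [r ME [H0 H1 H2 H3]]] := H q (leqnn q).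
exists E => //; split.
- by move=> i j /(H2 _ _ (ltn_ord j))[].
- by move=> i j /(H2 _ _ (ltn_ord j))[].
- by move=> i j i' j'; apply: H3.
- move=> i i' Ei ii'; apply/rowP=> j; rewrite !mxE; apply: H0 => //.
  rewrite leqNgt; apply/negP => i'r.
  have [j' _ /pivot_neq0] := H1 i (ltn_trans ii' i'r).
  by move/rowP/(_ j'): Ei; rewrite !mxE => ->; rewrite eqxx.
Qed.

Definition RREF (F : fieldType) (p q : nat) (M : 'M[F]_(p, q)) :
  'M[F]_(p, q) := s2val (RREF_sig M).

Lemma row_equiv_RREF (F : fieldType) (p q : nat) (M : 'M[F]_(p, q)) :
  row_equiv M (RREF M).
Proof. exact: s2valP. Qed.

Lemma is_rref_RREF (F : fieldType) (p q : nat) (M : 'M[F]_(p, q)) :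
  is_rref (RREF M).
Proof. exact: s2valP'. Qed.

Lemma row_op_sym (F : fieldType) (p q : nat) (M N : 'M[F]_(p, q)) :
  row_op M N -> row_op N M.
Proof.
case=> [i c c0|i k|k i c ki].
- suff {2}->: M = scale_row i c^-1 (scale_row i c M).
    by apply: RowScale; rewrite invr_eq0.
  by apply/matrixP=> l j; rewrite !mxE; case: eqP => // _; rewrite mulKf.
- suff {2}->: M = xrow i k (xrow i k M) by apply: RowSwap.
  by apply/matrixP=> l j; rewrite !mxE tpermK.
- suff {2}->: M = sub_row k i (- c) (sub_row k i c M) by apply: RowSub.
  apply/matrixP=> l j; rewrite !mxE [i == k]eq_sym (negPf ki).
  by case: eqP => // _; rewrite mulNr opprK subrK.
Qed.

Lemma row_equiv_sym (F : fieldType) (p q : nat) (M N : 'M[F]_(p, q)) :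
  row_equiv M N -> row_equiv N M.
Proof.
elim=> [A B /row_op_sym|A|A B C _ BA _ CB]; first exact: rt_step.
  exact: rt_refl.
exact: rt_trans CB BA.
Qed.

Lemma row_op_submx (F : fieldType) (p q : nat) (M N : 'M[F]_(p, q)) :
  row_op M N -> (N <= M)%MS.
Proof.
move=> op; apply/row_subP=> l; case: op => [i c _|i k|k i c _].
- have [li|li] := eqVneq l i.
    rewrite (_ : row l _ = c *: row l M) ?scalemx_sub ?row_sub //.
    by apply/rowP=> j; rewrite !mxE li eqxx.
  rewrite (_ : row l _ = row l M) ?row_sub //.
  by apply/rowP=> j; rewrite !mxE (negPf li).
- rewrite (_ : row l _ = row (tperm i k l) M) ?row_sub //.
  by apply/rowP=> j; rewrite !mxE.
- have [lk|lk] := eqVneq l k.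
    rewrite (_ : row l _ = row l M - c *: row i M).
      by rewrite addmx_sub ?eqmx_opp ?scalemx_sub ?row_sub.
    by apply/rowP=> j; rewrite !mxE lk eqxx.
  rewrite (_ : row l _ = row l M) ?row_sub //.
  by apply/rowP=> j; rewrite !mxE (negPf lk).
Qed.

Lemma row_equiv_eqmx (F : fieldType) (p q : nat) (M N : 'M[F]_(p, q)) :
  row_equiv M N -> (M :=: N)%MS.
Proof.
suff sub (A B : 'M[F]_(p, q)) : row_equiv A B -> (B <= A)%MS.
  by move=> MN; apply/eqmxP; rewrite !sub //; apply: row_equiv_sym.
elim=> {A B} [A B|A|A B C _ BA _ CB]; first exact: row_op_submx.
  exact: submx_refl.
exact: submx_trans CB BA.
Qed.

Lemma rref_coord (F : fieldType) (p q : nat) (E : 'M[F]_(p, q))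
    (w : 'rV[F]_p) i j :
  is_rref E -> pivot E i j -> (w *m E) 0 j = w 0 i.
Proof.
move=> [e1 e2 _ _] pij; rewrite mxE (bigD1 i) //= (e1 _ _ pij) mulr1.
by rewrite big1 ?addr0 // => l li; rewrite (e2 _ _ pij) // mulr0.
Qed.

Lemma rref_lead (F : fieldType) (p q : nat) (E : 'M[F]_(p, q))
    (u : 'rV[F]_q) j :
  is_rref E -> (u <= E)%MS -> pivot u 0 j -> exists i, pivot E i j.
Proof.
move=> rE /submxP[w ->] pj.
have [i nz|all0] := pickP (fun i => w 0 i * E i j != 0); last first.
  have /eqP[] := pivot_neq0 pj.
  by rewrite mxE big1 // => i _; apply/eqP/negbFE/all0.
move: nz; rewrite mulf_eq0 negb_or => /andP[wi Eij].
have [j' pij'] := pivot_ex Eij; exists i.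
suff <- : j' = j by [].
apply/val_inj/eqP; rewrite eqn_leq (pivot_le pij' Eij).
by rewrite (pivot_le pj) // (rref_coord w rE pij').
Qed.

Lemma rref_eq0 (F : fieldType) (p q : nat) (E : 'M[F]_(p, q))
    (u : 'rV[F]_q) :
  is_rref E -> (u <= E)%MS -> (forall i j, pivot E i j -> u 0 j = 0) -> u = 0.
Proof.
move=> rE uE u0; apply/rowP=> j; rewrite [RHS]mxE; apply/eqP/negPn/negP=> nz.
have [j' pj'] := pivot_ex nz; have [i pij'] := rref_lead rE uE pj'.
by have /eqP := pivot_neq0 pj'; rewrite (u0 _ _ pij').
Qed.

Lemma pivot_row (F : fieldType) (p q : nat) (E : 'M[F]_(p, q)) i j :
  pivot (row i E) 0 j = pivot E i j.
Proof. by rewrite /pivot !mxE; under eq_forallb do rewrite mxE. Qed.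

Lemma rref_pivot_eqmx (F : fieldType) (p q : nat) (E E' : 'M[F]_(p, q)) i :
  is_rref E -> is_rref E' -> (E :=: E')%MS ->
  forall j, pivot E i j -> pivot E' i j.
Proof.
move=> rE rE' eqE.
have tr (A B : 'M[F]_(p, q)) k j : is_rref B -> (A :=: B)%MS ->
    pivot A k j -> exists l, pivot B l j.
  move=> rB AB pj; apply: (@rref_lead _ _ _ _ (row k A)) => //.
    by rewrite -AB row_sub.
  by rewrite pivot_row.
have half (A B : 'M[F]_(p, q)) (k : 'I_p) (j : 'I_q) : is_rref A -> is_rref B -> (A :=: B)%MS ->
    (forall l : 'I_p, (l < k)%N -> forall j, pivot B l j -> pivot A l j) ->
    pivot A k j -> exists2 j' : 'I_q, (j' <= j)%N & pivot B k j'.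
  move=> rA [b1 b2 b3 b4] AB IH pj.
  have [l pl] := tr _ _ _ _ (And4 b1 b2 b3 b4) AB pj.
  case: (ltngtP l k) => [lk|kl|/val_inj <-]; last by exists j.
    have := IH _ lk _ pl; case: rA => _ a2 _ _ /pivot_neq0.
    by rewrite (a2 _ _ pj) ?eqxx // neq_ltn lk.
  have [j1 nz|all0] := pickP (fun j => B k j != 0); last first.
    have /rowP/(_ j) : row l B = 0.
      apply: b4 kl; apply/rowP=> j1; rewrite !mxE.
      exact/eqP/negbFE/all0.
    by rewrite !mxE => Bl; have := pivot_neq0 pl; rewrite Bl eqxx.
  have [j2 pj2] := pivot_ex nz; exists j2 => //.
  rewrite leqNgt; apply/negP=> /(b3 _ _ _ _ pl pj2).
  by rewrite ltnNge ltnW.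
suff iff_n n : forall k : 'I_p, (k < n)%N ->
    forall j, pivot E k j <-> pivot E' k j.
  by move=> j /(iff_n _ _ (ltn_ord i)).
elim: n => // n IH k; rewrite ltnS => kn.
have IHl (l : 'I_p) : (l < k)%N -> forall j, pivot E l j <-> pivot E' l j.
  by move=> lk; apply: IH; apply: leq_trans kn.
have eqE' : (E' :=: E)%MS by apply: eqmx_sym.
have h1 j := half E E' k j rE rE' eqE (fun l lk j => (IHl l lk j).2).
have h2 j := half E' E k j rE' rE eqE' (fun l lk j => (IHl l lk j).1).
move=> j; split=> pj.
  have [j' jj' pj'] := h1 _ pj; have [j2 j2j' pj2] := h2 _ pj'.
  have ej := pivot_row_inj pj2 pj; subst j2.
  suff <- : j' = j by [].
  by apply/val_inj/eqP; rewrite eqn_leq jj' j2j'.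
have [j' jj' pj'] := h2 _ pj; have [j2 j2j' pj2] := h1 _ pj'.
have ej := pivot_row_inj pj2 pj; subst j2.
suff <- : j' = j by [].
by apply/val_inj/eqP; rewrite eqn_leq jj' j2j'.
Qed.

Lemma rref_eqmx (F : fieldType) (p q : nat) (E E' : 'M[F]_(p, q)) :
  is_rref E -> is_rref E' -> (E :=: E')%MS -> E = E'.
Proof.
move=> rE rE' eqE; apply/row_matrixP=> i; apply/eqP.
rewrite -subr_eq0; apply/eqP; apply: (rref_eq0 rE).
  by rewrite addmx_sub ?eqmx_opp ?row_sub // eqE row_sub.
move=> k j pk; have pk' := rref_pivot_eqmx rE rE' eqE pk.
have [e1 e2 _ _] := rE; have [e1' e2' _ _] := rE'.
rewrite !mxE; have [->|ik] := eqVneq i k.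
  by rewrite (e1 _ _ pk) (e1' _ _ pk') subrr.
by rewrite (e2 _ _ pk) // (e2' _ _ pk') // subrr.
Qed.

Lemma RREF_uniq (F : fieldType) (p q : nat) (M E : 'M[F]_(p, q)) :
  is_rref E -> row_equiv M E -> RREF M = E.
Proof.
move=> rE ME; apply: rref_eqmx (is_rref_RREF M) rE _.
apply: eqmx_trans (row_equiv_eqmx ME).
exact/eqmx_sym/row_equiv_eqmx/row_equiv_RREF.
Qed.

(* Main.v *)
(* The columns of the cokernel matrix of M lie in null(M); if null(M) is
   contained in null(M'), then M' annihilates them, which says that every row of
   M' is a combination of the rows of M.  Equal row spaces in turn give equal
   RREFs, since a matrix in RREF is determined by its row space. *)
Require Import Defs.
From HB Require Import structures.
From mathcomp Require Import all_boot all_order perm all_algebra.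
From Stdlib Require Import Relation_Operators.
Import GRing.Theory.
Local Open Scope ring_scope.

Lemma null_submx (F : fieldType) (p p' q : nat)
    (M : 'M[F]_(p, q)) (M' : 'M[F]_(p', q)) :
  {subset null M <= null M'} -> (M' <= M)%MS.
Proof.
(* [submxE] reduces the goal to [M' *m cokermx M = 0], checked one column at a time. *)
move=> sub; rewrite submxE; apply/eqP/matrixP => i j.
have /sub : col j (cokermx M) \in null M.
  by rewrite inE colE mulmxA mulmx_coker mul0mx.
by rewrite inE colE mulmxA -colE => /eqP/colP/(_ i); rewrite 3!mxE => ->; rewrite mxE.
Qed.

Lemma null_eqmx (F : fieldType) (p p' q : nat)
    (M : 'M[F]_(p, q)) (M' : 'M[F]_(p', q)) :
  null M =i null M' -> (M :=: M')%MS.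
Proof.
by move=> eqN; apply/eqmxP; rewrite !null_submx // => x; rewrite eqN.
Qed.

(** Each row of [M] is some [w *m M'], a linear combination of the generators of [row_space M']. *)
Lemma row_space_subv (F : fieldType) (p p' q : nat)
    (M : 'M[F]_(p, q)) (M' : 'M[F]_(p', q)) :
  (M <= M')%MS -> (row_space M <= row_space M')%VS.
Proof.
move=> /row_subP sMM'; apply/span_subvP => _ /imageP[i _ ->].
have /submxP[w ->] := sMM' i; rewrite mulmx_sum_row.
by apply: memv_suml => k _; apply/memvZ/memv_span/image_f.
Qed.

Lemma eqmx_RREF (F : fieldType) (p q : nat) (M M' : 'M[F]_(p, q)) :
  (M :=: M')%MS -> RREF M = RREF M'.
Proof.
(* Row operations preserve row spaces, so both RREFs inherit the common one. *)
move=> eqM; apply: rref_eqmx; [exact: is_rref_RREF | exact: is_rref_RREF |].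
apply: eqmx_trans (row_equiv_eqmx (row_equiv_RREF M')).
exact: eqmx_trans (eqmx_sym (row_equiv_eqmx (row_equiv_RREF M))) eqM.
Qed.

Theorem corollary1 (F : fieldType) (q : nat) :
  (forall (p p' : nat) (M : 'M[F]_(p, q)) (M' : 'M[F]_(p', q)),
     null M =i null M' -> row_space M = row_space M') /\
  (forall (p : nat) (M M' : 'M[F]_(p, q)),
     null M =i null M' -> RREF M = RREF M' /\ row_equiv M M').
Proof.
split=> [p p' M M' /null_eqmx eqM | p M M' /null_eqmx/eqmx_RREF eqR].
  by apply/eqP; rewrite eqEsubv !row_space_subv ?eqM.
(* Reduce [M] to the common RREF, then reverse the reduction of [M']. *)
split=> //; apply: rt_trans (row_equiv_RREF M) _.
by rewrite eqR; apply/row_equiv_sym/row_equiv_RREF.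
Qed.
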